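(* For every integer $n>1$ there exists a piecewise linear, periodic map of the plane $\mathbb{R}^2$ with integer coefficients whose period is $n$.
   Context: A piecewise linear map of the plane with integer coefficients is a continuous map $f:\mathbb{R}^2\to\mathbb{R}^2$ for which the plane is a union of finitely many closed cones with apex at the origin, such that on each of these cones $f$ coincides with the linear map given by some $2\times 2$ matrix with integer entries (the number of cones is arbitrary but finite). The map $f$ is periodic if $f^n=\mathrm{id}$ for some integer $n\ge1$, and its period is the least such $n$. *)

(* Defs.v *)
From mathcomp Require Import all_boot all_order all_algebra.
From mathcomp Require Import all_classical all_reals all_analysis.

Set Implicit Arguments.
Unset Strict Implicit.
Unset Printing Implicit Defensive.

Import Order.TTheory GRing.Theory Num.Theory.
Import numFieldNormedType.Exports.

Local Open Scope classical_set_scope.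
Local Open Scope ring_scope.

(* Convexity is not required: a cone is a union of rays issuing from the
   apex. *)
Definition closed_cone (R : realType) (C : set 'cV[R]_2) : Prop :=
  [/\ closed C, C 0 & forall (t : R) x, 0 <= t -> C x -> C (t *: x)].

(* The matrices are over [int] and are cast to [R] entrywise to act on column
   vectors. *)
Definition piecewise_linear_int (R : realType) (f : 'cV[R]_2 -> 'cV[R]_2) :
    Prop :=
  continuous f /\
  exists (k : nat) (C : 'I_k -> set 'cV[R]_2) (A : 'I_k -> 'M[int]_2),
    [/\ forall i, closed_cone (C i),
        forall x, exists i, C i x
      & forall i x, C i x -> f x = map_mx intr (A i) *m x].

Definition has_period (T : Type) (f : T -> T) (n : nat) : Prop :=
  [/\ (0 < n)%N, iter n f =1 id
    & forall m, (0 < m)%N -> iter m f =1 id -> (n <= m)%N].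

(* Main.v *)
Require Import Defs.
From mathcomp Require Import all_boot all_order all_algebra.
From mathcomp Require Import all_classical all_reals all_analysis.
From mathcomp Require Import lra zify.

Set Implicit Arguments.
Unset Strict Implicit.
Unset Printing Implicit Defensive.

Import Order.TTheory GRing.Theory Num.Theory.
Import numFieldNormedType.Exports.

Local Open Scope classical_set_scope.
Local Open Scope ring_scope.

(** For n = 2 the map x |-> - x works.  For n >= 3 the idea comes from toric
    geometry.  Take integer vectors v_0, ..., v_(n-1) going once around the
    origin, in cyclic order, so that any two neighbours form a basis of Z^2 of
    determinant 1 (a complete smooth fan with n rays), and let f send v_i to
    v_(i+1), indices modulo n, and be linear on each cone spanned by v_i and
    v_(i+1).  On that cone f is W_(i+1) W_i^-1, where W_i is the matrix with
    columns v_i and v_(i+1); this has integer entries because det W_i = 1.  A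
    point W_i c, with c having nonnegative coordinates, is sent by the k-th
    iterate to W_(i+k) c; hence the n-th iterate is the identity, while a
    k-th iterate with 0 < k < n moves v_0 to v_k.  This is
    [fan_rotation_PL] and [fan_rotation_period]; continuity is automatic, since
    f is continuous on each of finitely many closed sets covering the plane
    ([continuous_closed_cover]).

    With n = m + 3, such a fan has the rays (1, 0), (1, 1), ..., (1, m),
    (0, 1), (-1, -1), in this order.  The map f is given by a formula in five
    cases ([fan_shift]) rather than by gluing the n linear pieces, so that there
    is nothing to check about the intersections of the cones: it suffices that
    the cones cover the plane ([ray_complete]) and that the formula rotates each
    of them, boundary rays included ([fan_shift_rotates]). *)

(** * Piecewise linear maps *)

(** Near x, only the finitely many closed sets that contain x matter: the
    others avoid a neighbourhood of x. *)
Lemma continuous_closed_cover (T U : topologicalType) (I : finType)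
    (C : I -> set T) (g : I -> T -> U) (f : T -> U) :
  (forall i, closed (C i)) -> (forall x, exists i, C i x) ->
  (forall i, continuous (g i)) -> (forall i x, C i x -> f x = g i x) ->
  continuous f.
Proof.
move=> Cclosed Ccover gcont fE x B fxB.
have near_piece i : \forall y \near x, C i y -> B (g i y).
  have [Cix|nCix] := pselect (C i x).
    rewrite (fE i) // in fxB; have gB : nbhs x (g i @^-1` B) := gcont i x B fxB.
    by apply: filterS gB => y.
  have := closed_openC (Cclosed i); rewrite openE => /(_ x nCix).
  by apply: filterS.
suff: nbhs x (f @^-1` B) by [].
near=> y; have [i Ciy] := Ccover y; rewrite /= (fE i) //.
by move: i Ciy; near: y; apply: filter_forall.
Unshelve. all: by end_near. Qed.

Lemma continuous_mulmx (R : realType) (M : 'M[R]_2) :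
  continuous (fun x : 'cV[R]_2 => M *m x).
Proof.
have -> : (fun x : 'cV[R]_2 => M *m x) =
    (fun x => x 0 0 *: col 0 M + x 1 0 *: col 1 M).
  apply/funext => x; apply/colP => i.
  rewrite !mxE big_ord_recl big_ord1 (_ : lift _ _ = 1); last exact/val_inj.
  by congr (_ + _); rewrite mulrC.
have term_cont j : continuous (fun x : 'cV[R]_2 => x j 0 *: col j M).
  by move=> x; apply: cvgZr_tmp; [exact: nbhs_filter | exact: coord_continuous].
move=> x; apply: cvgD; first exact: nbhs_filter.
- exact: term_cont.
- exact: term_cont.
Qed.

Definition nonneg (R : realType) (c : 'cV[R]_2) := forall j, 0 <= c j 0.

Lemma closed_cone_dual (R : realType) (M : 'M[R]_2) :
  closed_cone [set x : 'cV[R]_2 | nonneg (M *m x)].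
Proof.
split.
- have -> : [set x : 'cV[R]_2 | nonneg (M *m x)] =
      \bigcap_(j in setT) [set x | 0 <= (M *m x) j 0].
    by apply/seteqP; split=> x /= Mx j *; apply: Mx.
  apply: closed_bigI => j _.
  have entry_cont : continuous (fun x : 'cV[R]_2 => (M *m x) j 0).
    move=> x; apply: (@continuous_comp _ _ _ (mulmx M)
      (fun y : 'cV[R]_2 => y j 0)); first exact: continuous_mulmx.
    exact: coord_continuous.
  exact: (continuous_closedP _).1 entry_cont _ (@closed_ge R 0).
- by move=> j; rewrite mulmx0 mxE.
- by move=> t x t0 Mx j; rewrite -scalemxAr mxE mulr_ge0.
Qed.

(** Continuity comes from the agreement of the linear maps on overlaps, which
    is implicit in f being a function. *)
Lemma piecewise_linear_int_of_closed_cones (R : realType) (k : nat)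
    (C : 'I_k -> set 'cV[R]_2) (A : 'I_k -> 'M[int]_2)
    (f : 'cV[R]_2 -> 'cV[R]_2) :
  (forall i, closed_cone (C i)) -> (forall x, exists i, C i x) ->
  (forall i x, C i x -> f x = map_mx intr (A i) *m x) ->
  piecewise_linear_int f.
Proof.
move=> Ccone Ccover fE; split; last by exists k, C, A.
apply: (@continuous_closed_cover _ _ _ C
  (fun i x => map_mx intr (A i) *m x)) => // i.
- by have [] := Ccone i.
- exact: continuous_mulmx.
Qed.

(** * Rotating the rays of a complete smooth fan *)

(** The column index c, a number 0 or 1, selects the ray v_i or v_(i+1). *)
Definition fan_mx (v : nat -> 'cV[int]_2) (i : nat) : 'M[int]_2 :=
  \matrix_(r, c) v (i + c)%N r 0.

(** When [nonneg c], this runs over the cone spanned by v_i and v_(i+1). *)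
Definition fan_point (R : realType) (v : nat -> 'cV[int]_2) (i : nat)
    (c : 'cV[R]_2) : 'cV[R]_2 := map_mx intr (fan_mx v i) *m c.

Section FanRotation.
Variables (R : realType) (n : nat) (v : nat -> 'cV[int]_2).
Variable f : 'cV[R]_2 -> 'cV[R]_2.
Hypothesis n_gt0 : (0 < n)%N.
Hypothesis v_periodic : forall i, v (i + n)%N = v i.
Hypothesis fan_smooth : forall i, (i < n)%N -> \det (fan_mx v i) = 1.
Hypothesis fan_complete : forall x : 'cV[R]_2,
  exists i c, [/\ (i < n)%N, nonneg c & x = fan_point v i c].
Hypothesis f_rotates : forall i c, (i < n)%N -> nonneg c ->
  f (fan_point v i c) = fan_point v i.+1 c.

(** The i-th cone is the set where the dual basis, given by the rows of W_i^-1,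
    is nonnegative; both this description and the linear map W_(i+1) W_i^-1
    have integer entries because W_i is unimodular. *)
Lemma fan_rotation_PL : piecewise_linear_int f.
Proof.
pose W i := fan_mx v i.
have WV (i : 'I_n) : W i \in unitmx by rewrite unitmxE fan_smooth ?unitr1.
have dualK (i : 'I_n) (x : 'cV[R]_2) :
    fan_point v i (map_mx intr (invmx (W i)) *m x) = x.
  by rewrite /fan_point mulmxA -map_mxM mulmxV // map_mx1 mul1mx.
apply: (@piecewise_linear_int_of_closed_cones R n
  (fun i => [set x | nonneg (map_mx intr (invmx (W i)) *m x)])
  (fun i => W i.+1 *m invmx (W i))).
- by move=> i; exact: closed_cone_dual.
- move=> x; have [i [c [ltin c0 ->]]] := fan_complete x.
  exists (Ordinal ltin) => /=.
  have WVi := WV (Ordinal ltin).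
  by rewrite /fan_point mulmxA -map_mxM mulVmx // map_mx1 mul1mx.
- move=> i x /= x0; rewrite -[in LHS](dualK i x) f_rotates //.
  by rewrite map_mxM -mulmxA.
Qed.

Lemma fan_point_mod i (c : 'cV[R]_2) : fan_point v (i %% n) c = fan_point v i c.
Proof.
rewrite /fan_point [in RHS](divn_eq i n).
elim: (i %/ n)%N => [|q IHq]; first by rewrite mul0n.
rewrite IHq mulSn; congr (map_mx _ _ *m _); apply/matrixP => r s; rewrite !mxE.
by rewrite -v_periodic; congr (v _ _ _); lia.
Qed.

(** Coordinates with respect to the adjacent rays are preserved by f. *)
Lemma iter_fan_rotation k i c : nonneg c ->
  iter k f (fan_point v i c) = fan_point v (i + k)%N c.
Proof.
move=> c0; elim: k => [|k IHk]; first by rewrite addn0.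
rewrite iterS IHk -fan_point_mod f_rotates ?ltn_pmod //.
by rewrite -fan_point_mod -(addn1 (_ %% _)) modnDml addn1 -addnS fan_point_mod.
Qed.

(** The period is not smaller than n because v_0 is sent to v_k by the k-th
    iterate. *)
Lemma fan_rotation_period :
  (forall k, (0 < k < n)%N -> v k <> v 0%N) -> has_period f n.
Proof.
move=> v_inj; split=> // [x|k k_gt0 fk].
  have [i [c [_ c0 ->]]] := fan_complete x.
  by rewrite iter_fan_rotation // -fan_point_mod modnDr fan_point_mod.
rewrite leqNgt; apply/negP => ltkn; apply: (v_inj k); first by rewrite k_gt0.
have e0_ge0 : nonneg (delta_mx 0 0 : 'cV[R]_2).
  by move=> j; rewrite mxE ler0n.
have := fk (fan_point v 0 (delta_mx 0 0)).
rewrite iter_fan_rotation // add0n => /colP vk.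
apply/colP => r; have := vk r.
rewrite /fan_point -!colE !mxE !addn0 => /intr_inj; exact.
Qed.

End FanRotation.

(** * A complete smooth fan with any number of rays *)

Definition vec2 (A : Type) (a b : A) : 'cV[A]_2 :=
  \col_i (if i == 0 then a else b).

Lemma vec2_eta (A : Type) (x : 'cV[A]_2) : x = vec2 (x 0 0) (x 1 0).
Proof.
apply/colP => i; rewrite mxE; case: (eqVneq i 0) => [-> //|i_neq0].
by congr (x _ _); apply/val_inj; case: i i_neq0 => [[|[|]]].
Qed.

Definition ray (m i : nat) : 'cV[int]_2 :=
  let r := (i %% m.+3)%N in
  if (r <= m)%N then vec2 1 r%:Z else if r == m.+1 then vec2 0 1
  else vec2 (-1) (-1).

Lemma ray_periodic m i : ray m (i + m.+3) = ray m i.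
Proof. by rewrite /ray modnDr. Qed.

Lemma ray_fan m i : (i <= m)%N -> ray m i = vec2 1 i%:Z.
Proof. by move=> leim; rewrite /ray modn_small ?leim //; lia. Qed.

Lemma ray_up m : ray m m.+1 = vec2 0 1.
Proof. by rewrite /ray modn_small // ltnn eqxx. Qed.

Lemma ray_down m : ray m m.+2 = vec2 (-1) (-1).
Proof. by rewrite /ray modn_small // ifF ?ifF //; lia. Qed.

Lemma ray_wrap m i : ray m (m.+3 + i) = ray m i.
Proof. by rewrite addnC ray_periodic. Qed.

Lemma ray_index_cases m i : (i < m.+3)%N ->
  [\/ (i < m)%N, i = m, i = m.+1 | i = m.+2].
Proof.
move=> lti; case: (ltngtP i m) => [?|?|?]; [exact: Or41| |exact: Or42].
by case: (eqVneq i m.+1) => [|?]; [exact: Or43|apply: Or44; lia].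
Qed.

Lemma det_vec2 (v : nat -> 'cV[int]_2) i :
  \det (fan_mx v i) = v i 0 0 * v i.+1 1 0 - v i.+1 0 0 * v i 1 0.
Proof.
rewrite (expand_det_row _ 0) !big_ord_recl big_ord0 /cofactor !det_mx11 !mxE /=.
rewrite addn0 addn1 expr0 expr1 !mul1r addr0 mulN1r mulrN.
have l01 k : lift (0 : 'I_2) (k : 'I_1) = 1 by rewrite ord1; apply/val_inj.
by rewrite !l01.
Qed.

Lemma ray_smooth m i : (i < m.+3)%N -> \det (fan_mx (ray m) i) = 1.
Proof.
move=> /ray_index_cases lti; rewrite det_vec2.
case: lti => [lti|->|->|->].
- by rewrite !ray_fan ?(ltnW lti) // !mxE /=; lia.
- by rewrite ray_fan // ray_up !mxE /=; lia.
- by rewrite ray_up ray_down !mxE.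
- by rewrite -[m.+3]addn0 ray_wrap ray_down ray_fan // !mxE.
Qed.

Lemma fan_point_vec2 (R : realType) (v : nat -> 'cV[int]_2) i (c : 'cV[R]_2) :
  fan_point v i c =
  vec2 ((v i 0 0)%:~R * c 0 0 + (v i.+1 0 0)%:~R * c 1 0)
       ((v i 1 0)%:~R * c 0 0 + (v i.+1 1 0)%:~R * c 1 0).
Proof.
rewrite [LHS]vec2_eta /fan_point !mxE !big_ord_recl !big_ord0 !mxE !addr0.
by rewrite (_ : lift _ _ = 1) ?addn0 ?addn1 //; apply/val_inj.
Qed.

Lemma nonneg_vec2 (R : realType) (a b : R) :
  0 <= a -> 0 <= b -> nonneg (vec2 a b).
Proof. by move=> a0 b0 j; rewrite mxE; case: ifP. Qed.

(** For a > 0, the index i is the integer part of the slope b / a. *)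
Lemma slope_index (R : realType) (m : nat) (a b : R) : 0 <= b -> b < m%:R * a ->
  exists2 i, (i < m)%N & i%:R * a <= b <= i.+1%:R * a.
Proof.
move=> b0; elim: m => [|m IHm] bma; first by lra.
have [ltb|leb] := ltP b (m%:R * a); last by exists m; rewrite // leb ltW.
by have [i lti ib] := IHm ltb; exists i; rewrite // ltnW.
Qed.

(** The point (a, b) lies in the cone of (0, 1) and (-1, -1) when a <= 0 and
    a <= b, in the cone of (-1, -1) and (1, 0) when b <= 0 and b <= a, and
    otherwise in the positive quadrant, which the rays (1, i) cut according to
    the slope b / a.  The coordinates given are the determinants of the point
    with the two adjacent rays. *)
Lemma ray_complete (R : realType) (m : nat) (x : 'cV[R]_2) :
  exists i c, [/\ (i < m.+3)%N, nonneg c & x = fan_point (ray m) i c].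
Proof.
rewrite [x]vec2_eta; move: (x 0 0) (x 1 0) => a b {x}.
have [/andP[a0 ab]|P4] := boolP ((a <= 0) && (a <= b)).
  exists m.+1, (vec2 (b - a) (- a)); split; first by lia.
    by apply: nonneg_vec2; lra.
  rewrite fan_point_vec2 ray_up ray_down !mxE /=.
  by congr vec2; lra.
have [b0|b0] := leP b 0.
  exists m.+2, (vec2 (- b) (a - b)); split => //.
    by apply: nonneg_vec2; lra.
  rewrite fan_point_vec2 ray_down -[m.+3]addn0 ray_wrap ray_fan // !mxE /=.
  by congr vec2; lra.
have a0 : 0 < a by lra.
have [mab|mab] := leP (m%:R * a) b.
  exists m, (vec2 a (b - m%:R * a)); split; first by lia.
    by apply: nonneg_vec2; lra.
  rewrite fan_point_vec2 ray_fan // ray_up !mxE /= -pmulrn.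
  by congr vec2; lra.
have [i lti /andP[ib bi]] := slope_index (ltW b0) mab.
exists i, (vec2 (i.+1%:R * a - b) (b - i%:R * a)); split; first by lia.
  by apply: nonneg_vec2; lra.
rewrite fan_point_vec2 !ray_fan ?(ltnW lti) // !mxE /= -!pmulrn -natr1.
by congr vec2; lra.
Qed.

(** The five cases are, in order, the cone of (0, 1) and (-1, -1); the cone of
    (-1, -1) and (1, 0); the union of the cones of (1, i) and (1, i + 1) for
    i + 1 < m, on all of which the map is the shear (a, b) |-> (a, a + b); the
    cone of (1, m - 1) and (1, m); and the cone of (1, m) and (0, 1).  The
    factor [(0 < m)%:R] is the first coordinate of the ray v_1, which is (1, 1) when
    0 < m and (0, 1) when m = 0; in the latter case the third and fourth cases
    do not occur. *)
Definition fan_shift (R : realType) (m : nat) (x : 'cV[R]_2) : 'cV[R]_2 :=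
  let a := x 0 0 in let b := x 1 0 in
  if (a <= 0) && (a <= b) then vec2 (- b) (a - b)
  else if b <= 0 then vec2 (- b + (a - b) * (0 < m)%:R) (a - b)
  else if b <= (m%:R - 1) * a then vec2 a (a + b)
  else if b <= m%:R * a then
    vec2 (m%:R * a - b) (a + (m%:R - 1) * (m%:R * a - b))
  else vec2 (m%:R * a - b) (a + m%:R * a - b).

(** On the interior of a cone the right case of [fan_shift] applies; on a
    boundary ray a neighbouring case may apply, but then p or q vanishes and
    both formulas agree. *)
Lemma fan_shift_rotates (R : realType) (m i : nat) (c : 'cV[R]_2) :
  (i < m.+3)%N -> nonneg c ->
  fan_shift m (fan_point (ray m) i c) = fan_point (ray m) i.+1 c.
Proof.
move=> /ray_index_cases lti c_ge0; move: (c_ge0 0) (c_ge0 1).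
rewrite !fan_point_vec2 /fan_shift.
move: (c 0 0) (c 1 0) => p q {c c_ge0} p0 q0.
rewrite !mxE /=.
have m0 : 0 <= m%:R :> R by [].
case: lti => [lti|->|->|->].
- rewrite (ray_fan (ltnW lti)) (ray_fan lti) !mxE /=.
  have s0 : 0 <= i%:R :> R by [].
  (* The products that appear below are atoms for lra, hence these facts. *)
  have sp0 : 0 <= i%:R * p by rewrite mulr_ge0.
  have sq0 : 0 <= i%:R * q by rewrite mulr_ge0.
  rewrite (leq_ltn_trans _ lti) // -!pmulrn -[i.+1%:R]natr1.
  have [pq0|pq0] := leP (p + q) 0.
    have [-> ->] : p = 0 /\ q = 0 by lra.
    rewrite ifT; last by lra.
    by congr vec2; lra.
  rewrite ifF; last by lra.
  (* The ray that follows (1, i + 1) is (0, 1) or (1, i + 2). *)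
  move: lti; rewrite leq_eqVlt => /orP[/eqP mE|lti].
    have tE : m%:R = i%:R + 1 :> R by rewrite -mE natr1.
    rewrite mE ray_up !mxE /= tE.
    case: ifP => [b0|_]; first by congr vec2; lra.
    case: ifP => [q0'|_].
      have -> : q = 0 by lra.
      by congr vec2; lra.
    rewrite ifT; last by lra.
    by congr vec2; lra.
  have ti : i%:R + 2 <= m%:R :> R by rewrite -natrD ler_nat addn2.
  have tp : 0 <= (m%:R - i%:R - 2) * p by rewrite mulr_ge0 //; lra.
  have tq : 0 <= (m%:R - i%:R - 2) * q by rewrite mulr_ge0 //; lra.
  rewrite (ray_fan lti) !mxE /= -pmulrn -!natr1.
  case: ifP => [b0|_]; first by congr vec2; lra.
  rewrite ifT; last by lra.
  by congr vec2; lra.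
- rewrite ray_fan // ray_up ray_down !mxE /= -!pmulrn.
  have mp0 : 0 <= m%:R * p by rewrite mulr_ge0.
  have [p_le0|p_gt0] := leP p 0.
    have -> : p = 0 by lra.
    rewrite ifT; last by lra.
    by congr vec2; lra.
  rewrite ifF; last by lra.
  case: ifP => [b0|_].
    have -> : q = 0 by lra.
    (* Here the point is (p, m p) with p > 0 and m p <= 0. *)
    have -> : (0 < m)%N = false.
      apply/negbTE; rewrite -(ltr_nat R) -leNgt.
      by rewrite -(ler_pM2r p_gt0) mul0r; lra.
    by rewrite (mulr0 (_ - _)); congr vec2; lra.
  rewrite ifF; last by lra.
  case: ifP => [q0'|_]; last by congr vec2; lra.
  have -> : q = 0 by lra.
  by congr vec2; lra.
- rewrite ray_up ray_down -[m.+3]addn0 ray_wrap ray_fan // !mxE /=.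
  by rewrite ifT; [congr vec2; lra | lra].
- rewrite ray_down -[m.+3]addn0 -[(m.+3 + 0).+1]addnS !ray_wrap ray_fan //.
  (* The ray after (1, 0) is (0, 1) or (1, 1). *)
  have [->|m_neq0] := eqVneq m 0%N.
    rewrite ray_up !mxE /=.
    case: ifP => [b0|_]; first by congr vec2; lra.
    by rewrite ifT; [congr vec2; lra | lra].
  have m_gt0 : (0 < m)%N by rewrite lt0n.
  rewrite (ray_fan m_gt0) m_gt0 !mxE /=.
  case: ifP => [b0|_]; first by congr vec2; lra.
  by rewrite ifT; [congr vec2; lra | lra].
Qed.

Lemma ray_neq0 m k : (0 < k < m.+3)%N -> ray m k <> ray m 0.
Proof.
case/andP=> k_gt0 /ray_index_cases ltk; rewrite [ray m 0]ray_fan //.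
case: ltk k_gt0 => [ltk|->|->|->] k_gt0 /colP rayE.
- by have := rayE 1; rewrite ray_fan ?(ltnW ltk) // !mxE /=; lia.
- by have := rayE 1; rewrite ray_fan // !mxE /=; lia.
- by have := rayE 0; rewrite ray_up !mxE.
- by have := rayE 0; rewrite ray_down !mxE.
Qed.

(** * The theorem *)

Lemma opp_PL (R : realType) : piecewise_linear_int (fun x : 'cV[R]_2 => - x).
Proof.
apply: (@piecewise_linear_int_of_closed_cones R 1 (fun=> setT) (fun=> - 1)).
- by move=> _; split=> //; exact: closedT.
- by move=> x; exists 0.
- by move=> _ x _; rewrite map_mxN map_mx1 mulNmx mul1mx.
Qed.

Lemma opp_period2 (R : realType) :
  has_period (fun x : 'cV[R]_2 => - x) 2.
Proof.
split=> // [x|[|[|m]] // _ /(_ (delta_mx 0 0))]; first by rewrite /= opprK.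
by move=> /= /colP/(_ 0); rewrite !mxE /=; lra.
Qed.

Theorem mainTheorem2 (R : realType) (n : nat) (hn : (1 < n)%N) :
  exists f : 'cV[R]_2 -> 'cV[R]_2, piecewise_linear_int f /\ has_period f n.
Proof.
case: n hn => [|[|[|m]]] // _.
  by exists -%R; split; [exact: opp_PL | exact: opp_period2].
have smooth := @ray_smooth m; have complete := @ray_complete R m.
have rotates := @fan_shift_rotates R m.
exists (fan_shift m); split.
  exact: fan_rotation_PL smooth complete rotates.
apply: (fan_rotation_period _ (@ray_periodic m) complete rotates) => //.
exact: ray_neq0.
Qed.
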